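(* Let $\Delta$ be an upward equilateral triangle of side length $n$ divided into $n^2$ unit triangles, and let $S$ be a spread-out arrangement of triangular holes in $\Delta$. Then every unit grid segment on the boundary of a saturated triangle (and not in the interior of a hole) is forced, and the remaining forced segments are exactly those obtained by repeatedly placing rhombi in the three corners of saturated triangles until obstructed by holes. That is, a unit grid segment of $\Delta$ not lying in the interior of a hole is forced if and only if it lies on the boundary of a saturated triangle, or it is a side of a rhombus obtained by the corner-placing procedure from some saturated triangle $T$ and some corner of $T$.
   Context: All triangles are equilateral and grid-aligned; ''upward'' means having the same orientation as $\Delta$, and ''downward'' the opposite orientation. The size of an upward triangle is its side length; the size of an empty or one-point intersection is $0$. An arrangement of triangular holes is a set $S$ of upward triangles in $\Delta$ with pairwise disjoint interiors and sizes summing to $n$ (the basic case being $n$ unit triangles). It is spread-out if $\sum_{s\in S}\mathrm{size}(s\cap T)\le\mathrm{size}(T)$ for every upward triangle $T\subseteq\Delta$; $T$ is saturated if equality holds. A rhombus is the union of two unit grid triangles sharing an edge (one upward, one downward); a rhombus tiling of $\Delta\setminus\bigcup_{s\in S}s$ is a partition (up to boundaries) of its unit triangles into rhombi. Such tilings exist when $S$ is spread-out. A unit grid segment not in the interior of a hole is forced if it is part of every rhombus tiling of $\Delta\setminus\bigcup_{s\in S}s$, i.e. in no such tiling is it the short diagonal (the edge shared by the two unit triangles) of a rhombus. Corner-placing procedure for a saturated triangle $T$ and a corner $c$ of $T$: for an upward unit triangle $u\subseteq T$, call the side of $u$ parallel to the side of $T$ opposite $c$ its far side, and call its other two sides near sides.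 Start with no rhombi. Whenever there is an upward unit triangle $u\subseteq T$ that is not contained in any hole, is not already covered, and is such that each of its two near sides either lies on the boundary of $T$ or is a side of a rhombus already placed by this procedure (for the same $T$ and $c$), place the rhombus formed by $u$ and the downward unit triangle adjacent to $u$ across its far side (this rhombus lies in $T$). Continue until no further rhombus can be placed (in particular the first rhombus, if any, is placed at the corner unit triangle of $T$ at $c$). *)

(* Defs.v *)
From mathcomp Require Import all_boot finmap zify.

Set Implicit Arguments.
Unset Strict Implicit.
Unset Printing Implicit Defensive.

Local Open Scope fset_scope.
Local Open Scope nat_scope.

(** Lattice points in oblique coordinates: [(a, b)] stands for the point
    [a e1 + b e2], where [e1] and [e2] are unit vectors at an angle of 60 degrees. *)
Definition point := (nat * nat)%type.

(** [(p, k)] is the upward triangle with vertices [p], [p + k e1], [p + k e2].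
    Triangles of interest have [0 < k]; see [upward_in]. *)
Definition triangle := (point * nat)%type.

Definition size_tri (T : triangle) : nat := T.2.

Definition Delta (n : nat) : triangle := ((0, 0), n).

Definition pt_in (T : triangle) (p : point) : bool :=
  [&& T.1.1 <= p.1, T.1.2 <= p.2 & p.1 + p.2 <= T.1.1 + T.1.2 + T.2].

(** Upward triangles contained in [Delta n]. *)
Definition upward_in (n : nat) (T : triangle) : bool :=
  (0 < T.2) && (T.1.1 + T.1.2 + T.2 <= n).

(** A nonempty intersection of two upward triangles is an upward triangle (or a
    point), obtained by intersecting the half-planes [a >= _], [b >= _] and
    [a + b <= _].  Truncated subtraction gives size 0 when the intersection is
    empty. *)
Definition cap (s T : triangle) : triangle :=
  let a := maxn s.1.1 T.1.1 in
  let b := maxn s.1.2 T.1.2 in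
  ((a, b), minn (s.1.1 + s.1.2 + s.2) (T.1.1 + T.1.2 + T.2) - (a + b)).

Lemma pt_in_cap (s T : triangle) (p : point) :
  0 < size_tri (cap s T) -> pt_in (cap s T) p = pt_in s p && pt_in T p.
Proof. by case: s T p => [[a b] k] [[x y] m] [i j]; rewrite /pt_in /cap /=; lia. Qed.

Lemma cap_size0 (s T : triangle) (p q : point) :
  size_tri (cap s T) = 0 -> pt_in s p && pt_in T p -> pt_in s q && pt_in T q -> p = q.
Proof.
case: s T p q => [[a b] k] [[x y] m] [i j] [i' j'].
rewrite /pt_in /size_tri /cap /= => h0 hp hq.
by congr pair; lia.
Qed.

(** The three directions of grid lines: [dir1] is parallel to [e1], [dir2] to
    [e2], and [dir3] to [e2 - e1]. *)
Variant direction := dir1 | dir2 | dir3.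

(** [Up p] has vertices [p], [p + e1], [p + e2];
    [Down p] has vertices [p + e1], [p + e2], [p + e1 + e2]. *)
Variant cell := Up of point | Down of point.

Definition vertices (c : cell) : seq point :=
  match c with
  | Up p => [:: p; (p.1.+1, p.2); (p.1, p.2.+1)]
  | Down p => [:: (p.1.+1, p.2); (p.1, p.2.+1); (p.1.+1, p.2.+1)]
  end.

Definition cell_in (T : triangle) (c : cell) : bool := all (pt_in T) (vertices c).

(** A unit segment is encoded as the side with the given direction of the unique
    upward unit triangle [Up p] it belongs to. *)
Definition segment := (point * direction)%type.

Definition endpoints (e : segment) : seq point :=
  let p := e.1 in
  match e.2 with
  | dir1 => [:: p; (p.1.+1, p.2)]
  | dir2 => [:: p; (p.1, p.2.+1)]
  | dir3 => [:: (p.1.+1, p.2); (p.1, p.2.+1)]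
  end.

Definition seg_in (T : triangle) (e : segment) : bool :=
  all (pt_in T) (endpoints e).

(** The side of the unit triangle [c] with direction [d]. *)
Definition side (c : cell) (d : direction) : segment :=
  match c, d with
  | Up p, _ => (p, d)
  | Down p, dir1 => ((p.1, p.2.+1), dir1)
  | Down p, dir2 => ((p.1.+1, p.2), dir2)
  | Down p, dir3 => (p, dir3)
  end.

Definition is_side (c : cell) (e : segment) : Prop := exists d, e = side c d.

(** [p] lies on the side of [T] with direction [d]. *)
Definition on_side (T : triangle) (d : direction) (p : point) : bool :=
  pt_in T p &&
  match d with
  | dir1 => p.2 == T.1.2
  | dir2 => p.1 == T.1.1
  | dir3 => p.1 + p.2 == T.1.1 + T.1.2 + T.2
  end.

Definition on_boundary (T : triangle) (e : segment) : Prop :=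
  exists d, all (on_side T d) (endpoints e).

Definition arrangement (n : nat) (S : {fset triangle}) : Prop :=
  [/\ forall s, s \in S -> upward_in n s,
      forall s t, s \in S -> t \in S -> s != t ->
        forall c, ~ (cell_in s c /\ cell_in t c)
    & \sum_(s <- S) size_tri s = n].

Definition spread_out (n : nat) (S : {fset triangle}) : Prop :=
  forall T, upward_in n T -> \sum_(s <- S) size_tri (cap s T) <= size_tri T.

Definition saturated (n : nat) (S : {fset triangle}) (T : triangle) : Prop :=
  upward_in n T /\ \sum_(s <- S) size_tri (cap s T) = size_tri T.

Definition in_hole (S : {fset triangle}) (c : cell) : Prop :=
  exists2 s, s \in S & cell_in s c.

(** The relative interior of the segment is meant: its endpoints may lie on the
    boundary of the hole. *)
Definition in_hole_interior (S : {fset triangle}) (e : segment) : Prop :=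
  exists s, [/\ s \in S, seg_in s e & ~ on_boundary s e].

(** [(u, v)] stands for the union of [Up u] and [Down v]; it is a rhombus when
    these two unit triangles share an edge; see [is_rhombus]. *)
Definition rhombus := (point * point)%type.

Definition covers (r : rhombus) (c : cell) : Prop := c = Up r.1 \/ c = Down r.2.

Definition short_diagonal (r : rhombus) (e : segment) : Prop :=
  is_side (Up r.1) e /\ is_side (Down r.2) e.

Definition is_rhombus (r : rhombus) : Prop := exists e, short_diagonal r e.

Definition rhombus_side (r : rhombus) (e : segment) : Prop :=
  (is_side (Up r.1) e \/ is_side (Down r.2) e) /\ ~ short_diagonal r e.

Definition free_cell (n : nat) (S : {fset triangle}) (c : cell) : Prop :=
  cell_in (Delta n) c /\ ~ in_hole S c.

Definition rhombus_tiling (n : nat) (S : {fset triangle}) (R : {fset rhombus}) : Prop :=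
  (forall r, r \in R ->
     is_rhombus r /\ forall c, covers r c -> free_cell n S c) /\
  (forall c, free_cell n S c -> exists! r, r \in R /\ covers r c).

Definition forced (n : nat) (S : {fset triangle}) (e : segment) : Prop :=
  forall R, rhombus_tiling n S R -> forall r, r \in R -> ~ short_diagonal r e.

(** A corner of [T] is designated by the direction [c] of the side of [T] opposite
    to it, so that the far side of [Up u] is [side (Up u) c].  [P] lists the rhombi
    placed so far.  No [r.2] exists when the triangle across the far side would
    have a negative coordinate; for a saturated [T] in a spread-out arrangement
    every placed rhombus lies in [T], so this case does not arise. *)
Definition can_place (S : {fset triangle}) (T : triangle) (c : direction)
    (P : seq rhombus) (r : rhombus) : Prop :=
  [/\ cell_in T (Up r.1),
      ~ in_hole S (Up r.1),
      ~ (exists2 q, q \in P & covers q (Up r.1)),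
      forall d, d <> c ->
        on_boundary T (side (Up r.1) d) \/
        exists2 q, q \in P & rhombus_side q (side (Up r.1) d)
    & side (Up r.1) c = side (Down r.2) c].

Inductive corner_run (S : {fset triangle}) (T : triangle) (c : direction) :
    seq rhombus -> Prop :=
  | corner_run_start : corner_run S T c [::]
  | corner_run_step P r :
      corner_run S T c P -> can_place S T c P r -> corner_run S T c (r :: P).

(** The order of placement is immaterial: being placeable persists until [Up r.1]
    is covered, so all complete runs place the same rhombi. *)
Definition corner_rhombus (S : {fset triangle}) (T : triangle) (c : direction)
    (r : rhombus) : Prop :=
  exists P, [/\ corner_run S T c P, forall q, ~ can_place S T c P q & r \in P].

(* Main.v *)
Require Import Defs.
From HB Require Import structures.
From mathcomp Require Import all_boot finmap zify.
From Stdlib Require Import Classical.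

(** A tiling is a perfect matching between the free upward and the free downward
    cells.  In a saturated triangle [T] there are as many free cells of both kinds
    and every downward cell of [T] has its neighbours in [T], so a tiling matches [T]
    within itself; this forces the boundary of [T], and then the corner rhombi one
    after the other.

    Conversely, suppose that the segment between the free cells [Up u] and [Down v]
    is forced.  By Hall's theorem a minimal set [B] of downward cells violates the
    marriage condition once [u] and [v] are removed.  Let [X] be [B] with the
    downward cells of the holes touching it, [A] the set of neighbours of [X]
    together with these holes, and [T] the smallest upward triangle containing [A].
    By minimality [A] is connected, and it meets the three sides of [T]; a connected
    set of upward cells of [T] disjoint from [A] therefore cannot meet all three (the
    game of Y has at most one winner).  Matching each component of the complement of
    [A] towards a side that it misses shows that [#|A| - #|X|] is at least the size of
    [T].  As [B] is a violator and [S] is spread-out, equality holds: [T] is saturated,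
    and the cells of [T] outside [A] and [X] are filled by corner rhombi, one of which
    contains [Down v] unless [v] lies outside [T]. *)

Set Implicit Arguments.
Unset Strict Implicit.
Unset Printing Implicit Defensive.

Local Open Scope fset_scope.
Local Open Scope nat_scope.

(** * Hall's theorem *)

Definition neighbours (K V : choiceType) (r : K -> {fset V}) (B : {fset K}) : {fset V} :=
  \bigcup_(b <- B) r b.

Lemma neighboursP (K V : choiceType) (r : K -> {fset V}) (B : {fset K}) u :
  reflect (exists2 b, b \in B & u \in r b) (u \in neighbours r B).
Proof.
apply: (iffP (bigfcupP _ _ _ _)) => [[b /andP[bB _] ub]|[b bB ub]].
  by exists b.
by exists b; rewrite ?bB.
Qed.

Lemma card_disjointU (K : choiceType) (A B : {fset K}) :
  (forall x, x \in A -> x \in B -> False) -> #|` A `|` B| = #|` A| + #|` B|.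
Proof.
move=> dAB; rewrite cardfsU; suff -> : A `&` B = fset0 by rewrite cardfs0 subn0.
by apply/eqP; rewrite -fsubset0; apply/fsubsetP => x /fsetIP[/dAB h /h].
Qed.

Lemma card_bigfcup (I K : choiceType) (s : seq I) (P : pred I) (F : I -> {fset K}) :
  uniq s ->
  (forall i j x, i \in s -> j \in s -> x \in F i -> x \in F j -> i = j) ->
  #|` \bigcup_(i <- s | P i) F i| = \sum_(i <- s | P i) #|` F i|.
Proof.
elim: s => [|i s IH] /=; first by rewrite !big_nil cardfs0.
case/andP=> nis us dF; rewrite !big_cons -IH //; last first.
  by move=> j k x js ks; apply: dF; rewrite inE ?js ?ks orbT.
case: (P i) => //; apply: card_disjointU => x xi /bigfcupP[j /andP[js _] xj].
by move/negP: nis; apply; rewrite (dF i j x) ?inE ?js ?eqxx ?orbT.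
Qed.

(** Induction on the size of [D]. If some nonempty proper [B] is tight, [B] and the rest are matched
    separately, the rest avoiding the neighbours of [B]. Otherwise every such [B] has a spare
    neighbour, and any one pair can be matched first. *)
Lemma hall (K V : choiceType) (x0 : V) (D : {fset K}) (r : K -> {fset V}) :
  (forall B, B `<=` D -> #|` B| <= #|` neighbours r B|) ->
  exists f : K -> V, {in D &, injective f} /\ {in D, forall b, f b \in r b}.
Proof.
have [m] := ubnP #|` D|; elim: m D r => // m IH D r ltDm hallD.
have [D0|[d dD]] := fset_0Vmem D.
  by exists (fun=> x0); split=> [x y|x]; rewrite D0 inE.
case: (classic (exists B, [/\ B `<` D, B != fset0 &
    #|` neighbours r B| <= #|` B|])) => [[B [ltBD B0 tightB]]|loose].
  have sBD := fproper_sub ltBD.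
  have [|B' sB'|f1 [inj1 r1]] := IH B r.
  - by have := fproper_ltn_card ltBD; lia.
  - by apply: hallD; apply: fsubset_trans sBD.
  have [||f2 [inj2 r2]] := IH (D `\` B) (fun b => r b `\` neighbours r B).
  - rewrite cardfsDS //; move: B0 (fproper_ltn_card ltBD).
    by rewrite -cardfs_gt0; lia.
  - move=> B' sB'; have dB : #|` B `|` B'| = #|` B| + #|` B'|.
      by apply: card_disjointU => x xB /(fsubsetP sB'); rewrite inE xB.
    have : #|` B `|` B'| <= #|` neighbours r (B `|` B')|.
      apply: hallD; rewrite fsubUset sBD; apply: fsubset_trans sB' _.
      exact: fsubsetDl.
    suff : neighbours r (B `|` B') `<=`
        neighbours r B `|` neighbours (fun b => r b `\` neighbours r B) B'.
      move/fsubset_leq_card; rewrite cardfsU; lia.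
    apply/fsubsetP => u /neighboursP[b /fsetUP bBB' ub]; rewrite inE.
    case: (boolP (u \in neighbours r B)) => //= nu.
    apply/neighboursP; exists b; last by rewrite inE nu ub.
    by case: bBB' => // bB; case/negP: nu; apply/neighboursP; exists b.
  exists (fun x => if x \in B then f1 x else f2 x).
  have cross x y : x \in B -> y \in D -> y \notin B -> f1 x = f2 y -> False.
    move=> xB yD yB e; have := r2 y; rewrite inE yB yD => /(_ isT).
    rewrite inE -e => /andP[/negP nf _]; apply: nf.
    by apply/neighboursP; exists x => //; apply: r1.
  split=> [x y xD yD|x xD] /=; last first.
    case: (boolP (x \in B)) => xB; first exact: r1.
    by have := r2 x; rewrite !inE xB xD => /(_ isT)/andP[].
  case: (boolP (x \in B)) => xB; case: (boolP (y \in B)) => yB e.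
  - exact: inj1.
  - by case: (cross x y).
  - by case: (cross y x).
  - by apply: inj2 => //; rewrite inE ?xB ?yB.
have [u ud] : exists u, u \in r d.
  have := hallD [fset d]; rewrite fsub1set dD cardfs1 => /(_ isT).
  rewrite cardfs_gt0 => /fset0Pn[u /neighboursP[b]]; rewrite inE => /eqP-> ud.
  by exists u.
have [||f [injf rf]] := IH (D `\ d) (fun b => r b `\ u).
- by move: ltDm; rewrite (cardfsD1 d) dD; lia.
- move=> B sB; have [->|B0] := eqVneq B fset0; first by rewrite cardfs0.
  have ltB : #|` B| < #|` neighbours r B|.
    rewrite ltnNge; apply/negP => tightB; apply: loose; exists B; split=> //.
    by apply: fsub_proper_trans sB _; rewrite fproperD1.
  suff : neighbours r B `<=` u |` neighbours (fun b => r b `\ u) B.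
    move/fsubset_leq_card; rewrite cardfsU1; case: (_ \notin _) => /=; lia.
  apply/fsubsetP => w /neighboursP[b bB wb]; rewrite !inE.
  have [//|nwu] /= := eqVneq w u.
  by apply/neighboursP; exists b; rewrite // !inE nwu.
exists (fun x => if x == d then u else f x).
have fu x : x \in D -> x != d -> f x \in r x /\ f x != u.
  by move=> xD xd; have := rf x; rewrite !inE xd xD => /(_ isT)/andP[].
split=> [x y xD yD|x xD] /=; last first.
  by have [->//|xd] := eqVneq x d; case: (fu x xD xd).
have [->|xd] := eqVneq x d; have [->|yd] := eqVneq y d => //.
- by move=> e; case: (fu y yD yd) => _; rewrite -e eqxx.
- by move=> e; case: (fu x xD xd) => _; rewrite e eqxx.
- by move=> e; apply: injf; rewrite // !inE ?xd ?yd.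
Qed.

Lemma minimal_violator (K V : choiceType) (r : K -> {fset V}) (D : {fset K}) :
  #|` neighbours r D| < #|` D| ->
  exists B, [/\ B `<=` D, #|` neighbours r B| < #|` B|
    & forall B', B' `<` B -> #|` B'| <= #|` neighbours r B'|].
Proof.
have [m] := ubnP #|` D|; elim: m D => // m IH D ltDm violD.
case: (classic (exists2 B', B' `<` D & #|` neighbours r B'| < #|` B'|)).
  case=> B' ltB' viol; have [|//|B [sB vB mB]] := IH B'.
    by have := fproper_ltn_card ltB'; lia.
  by exists B; split=> //; apply: fsubset_trans sB (fproper_sub ltB').
move=> nviol; exists D; split=> // B' ltB'; rewrite leqNgt.
by apply/negP => viol; apply: nviol; exists B'.
Qed.

(** * Cells of a triangle *)

HB.lock Definition ups (T : triangle) : {fset point} :=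
  [fset p in [seq (i, j) | i <- iota T.1.1 T.2, j <- iota T.1.2 T.2]
     | cell_in T (Up p)].

HB.lock Definition downs (T : triangle) : {fset point} :=
  [fset p in [seq (i, j) | i <- iota T.1.1 T.2, j <- iota T.1.2 T.2]
     | cell_in T (Down p)].

Lemma in_ups T p : (p \in ups T) =
  [&& T.1.1 <= p.1, T.1.2 <= p.2 & p.1 + p.2 < T.1.1 + T.1.2 + T.2].
Proof.
rewrite ups.unlock !inE /=; apply/idP/idP => [/andP[_]|h].
  by rewrite /cell_in /= /pt_in /=; lia.
apply/andP; split; last by rewrite /cell_in /= /pt_in /=; lia.
by apply/allpairsP; exists p; case: p h => i j /= h; split; rewrite ?mem_iota //; lia.
Qed.

Lemma in_downs T p : (p \in downs T) =
  [&& T.1.1 <= p.1, T.1.2 <= p.2 & (p.1 + p.2).+1 < T.1.1 + T.1.2 + T.2].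
Proof.
rewrite downs.unlock !inE /=; apply/idP/idP => [/andP[_]|h].
  by rewrite /cell_in /= /pt_in /=; lia.
apply/andP; split; last by rewrite /cell_in /= /pt_in /=; lia.
by apply/allpairsP; exists p; case: p h => i j /= h; split; rewrite ?mem_iota //; lia.
Qed.

Lemma cell_in_Up T p : cell_in T (Up p) = (p \in ups T).
Proof. by rewrite in_ups /cell_in /= /pt_in /=; lia. Qed.

Lemma cell_in_Down T p : cell_in T (Down p) = (p \in downs T).
Proof. by rewrite in_downs /cell_in /= /pt_in /=; lia. Qed.

Lemma downs_ups T : downs T `<=` ups T.
Proof. by apply/fsubsetP => p; rewrite in_ups in_downs; lia. Qed.

(** [Up p] and [Down p] share their [dir3] side; the upward cells without such a partner in [T] are
    the [T.2] ones along its side of direction [dir3]. *)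
Lemma card_ups T : #|` ups T| = #|` downs T| + T.2.
Proof.
case: T => [[a b] k].
pose top := [fset (a + i, b + (k.-1 - i)) | i in iota 0 k].
have -> : ups ((a, b), k) = downs ((a, b), k) `|` top.
  apply/fsetP => -[x y]; rewrite inE in_ups in_downs /=.
  apply/idP/idP => [h|/orP[h|/imfsetP[i /= ]]].
  - case: (ltnP (x + y).+1 (a + b + k)) => hk; first by apply/orP; left; lia.
    apply/orP; right; apply/imfsetP; exists (x - a) => /=.
      by rewrite mem_iota; lia.
    by congr pair; lia.
  - lia.
  - by rewrite mem_iota => hi [-> ->]; lia.
rewrite card_disjointU; last first.
  move=> [x y]; rewrite in_downs /= => h /imfsetP[i /=].
  by rewrite mem_iota => hi [??]; lia.
congr (_ + _); rewrite card_in_imfset /=; last first.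
  by move=> i j _ _ [?]; lia.
by rewrite undup_id ?size_iota //; apply: iota_uniq.
Qed.

(** As a segment is named after its upward cell, [nbr v d = p] says that [(p, d)] is a side of
    [Down v]. *)
Definition nbr (v : point) (d : direction) : point := (side (Down v) d).1.

Definition nb (v : point) : {fset point} := [fset nbr v dir1; nbr v dir2; nbr v dir3].

Lemma in_nb v p : (p \in nb v) =
  [&& v.1 <= p.1, v.2 <= p.2 & p.1 + p.2 <= (v.1 + v.2).+1].
Proof.
case: v p => [a b] [x y]; rewrite !inE /nbr /= !xpair_eqE; lia.
Qed.

Lemma nbr_nb v d : nbr v d \in nb v.
Proof. by case: v d => [a b] []; rewrite in_nb /nbr /=; lia. Qed.

Lemma nbP v p : p \in nb v -> exists d, p = nbr v d.
Proof.
by rewrite !inE => /orP[/orP[]|] /eqP ->; [exists dir1|exists dir2|exists dir3].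
Qed.

Lemma nb_downs T v p : v \in downs T -> p \in nb v -> p \in ups T.
Proof. by case: v p => [a b] [x y]; rewrite in_nb in_downs in_ups /=; lia. Qed.

(* [Up p] and [Up q] meet a common downward cell, or [p = q]. *)
Definition adj (p q : point) : bool :=
  [&& p.1 <= q.1.+1, q.1 <= p.1.+1, p.2 <= q.2.+1, q.2 <= p.2.+1,
      p.1 + p.2 <= (q.1 + q.2).+1 & q.1 + q.2 <= (p.1 + p.2).+1].

Lemma adj_sym p q : adj p q = adj q p.
Proof. by case: p q => [a b] [x y]; rewrite /adj /=; lia. Qed.

Lemma adj_nb v p q : p \in nb v -> q \in nb v -> adj p q.
Proof. by case: v p q => [a b] [x y] [i j]; rewrite !in_nb /adj /=; lia. Qed.

Lemma adjP p q : adj p q -> exists2 v, p \in nb v & q \in nb v.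
Proof.
case: p q => [a b] [x y] h.
case: (leqP (a + b) (x + y)) => h1.
  case: (leqP a x) => h2; case: (leqP b y) => h3.
  - by exists (a, b); rewrite in_nb /=; move: h; rewrite /adj /=; lia.
  - by exists (a, y); rewrite in_nb /=; move: h; rewrite /adj /=; lia.
  - by exists (x, b); rewrite in_nb /=; move: h; rewrite /adj /=; lia.
  - lia.
case: (leqP a x) => h2; case: (leqP b y) => h3.
- lia.
- by exists (a, y); rewrite in_nb /=; move: h; rewrite /adj /=; lia.
- by exists (x, b); rewrite in_nb /=; move: h; rewrite /adj /=; lia.
- by exists (x, y); rewrite in_nb /=; move: h; rewrite /adj /=; lia.
Qed.

(* The downward cells around a common [Up p] are positioned like pairwise
   adjacent upward cells. *)
Lemma adj_dual v w p : p \in nb v -> p \in nb w -> adj v w.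
Proof. by case: v w p => [a b] [x y] [i j]; rewrite !in_nb /adj /=; lia. Qed.

(** * The game of Y *)

Definition closed_in (A C : {fset point}) : Prop :=
  forall p q, p \in C -> q \in A -> adj p q -> q \in C.

Definition connected (A : {fset point}) : Prop :=
  forall C, C `<=` A -> C != fset0 -> closed_in A C -> A `<=` C.

(** For [Up p] in [T]: its side of direction [d] lies on that side of [T]. On the [dir3] side of
    [Up p] the coordinate sum is one more than at [p], whence the successor. *)
Definition touch (T : triangle) (d : direction) (p : point) : bool :=
  match d with
  | dir1 => p.2 == T.1.2
  | dir2 => p.1 == T.1.1
  | dir3 => (p.1 + p.2).+1 == T.1.1 + T.1.2 + T.2
  end.

Definition touches (T : triangle) (d : direction) (A : {fset point}) : bool :=
  has (touch T d) A.

Definition majority (A : {fset point}) (v : point) : bool :=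
  let x := v \in A in let y := (v.1.+1, v.2) \in A in let z := (v.1, v.2.+1) \in A in
  [|| x && y, x && z | y && z].

Lemma majorityI A v p q :
  p \in nb v -> q \in nb v -> p \in A -> q \in A -> p != q -> majority A v.
Proof.
rewrite /majority !inE /nbr /=.
by case/orP => [/orP[]|] /eqP-> ; case/orP => [/orP[]|] /eqP-> hp hq;
  rewrite ?hp ?hq ?eqxx ?orbT.
Qed.

Lemma majorityE A v : majority A v -> exists2 p, p \in nb v & p \in A.
Proof.
have h d : nbr v d \in A -> exists2 p, p \in nb v & p \in A.
  by exists (nbr v d); rewrite // nbr_nb.
rewrite /majority -[in v \in A](_ : nbr v dir3 = v) /=; last by case: (v).
by case/or3P => /andP[]; first [by move=> /(h dir3) | by move=> /(h dir2)].
Qed.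

Lemma majority_disjoint A B v :
  (forall x, x \in A -> x \in B -> False) -> majority A v -> majority B v -> False.
Proof.
move=> dAB; rewrite /majority => /or3P[]/andP[h1 h2] /or3P[]/andP[h3 h4];
  by [apply: dAB h1 h3|apply: dAB h1 h4|apply: dAB h2 h3|apply: dAB h2 h4].
Qed.

(** Downward cells of a triangle of size [k.+1] have the coordinates of the upward cells of size [k]
    at the same corner, so the result is again a position on a board. *)
Definition reduct (A : {fset point}) (T : triangle) : {fset point} :=
  [fset v in downs T | majority A v].

Lemma in_reduct A T v : (v \in reduct A T) = (v \in downs T) && majority A v.
Proof. by rewrite mem_imfset. Qed.

Lemma reductI A T v p q : A `<=` ups T ->
  p \in nb v -> q \in nb v -> p \in A -> q \in A -> p != q -> v \in reduct A T.
Proof.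
move=> sA pv qv pA qA pq; rewrite in_reduct (majorityI pv qv pA qA pq) andbT.
move/(fsubsetP sA): pA; move/(fsubsetP sA): qA; move: pq pv qv.
case: p q => [a b] [x y]; rewrite xpair_eqE !in_nb !in_ups in_downs /=; lia.
Qed.

(** The cells of [A] around cells of [C] form a closed part of [A]: two distinct adjacent cells of
    [A] share a downward cell, which has a majority and is adjacent to a cell of [C]. Hence they are
    all of [A]. *)
Lemma reduct_connected A T : A `<=` ups T -> connected A -> connected (reduct A T).
Proof.
move=> sA cA C sC C0 clC.
pose E := [fset p in A | has (fun v => p \in nb v) C].
have inE' p : (p \in E) = (p \in A) && has (fun v => p \in nb v) C.
  by rewrite mem_imfset.
have meet v : v \in reduct A T -> exists2 p, p \in nb v & p \in A.
  by rewrite in_reduct => /andP[_ /majorityE].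
have sAE : A `<=` E.
  apply: cA.
  - by apply/fsubsetP => p; rewrite inE' => /andP[].
  - case/fset0Pn: C0 => v vC; case: (meet v (fsubsetP sC v vC)) => p pv pA.
    by apply/fset0Pn; exists p; rewrite inE' pA; apply/hasP; exists v.
  move=> p q; rewrite !inE' => /andP[pA /hasP[v vC pv]] qA pq; rewrite qA.
  have [<-|npq] := eqVneq p q; first by apply/hasP; exists v.
  case: (adjP pq) => w pw qw; apply/hasP; exists w => //.
  by apply: clC vC _ (adj_dual pv pw); apply: reductI npq.
apply/fsubsetP => v vR; case: (meet v vR) => p pv /(fsubsetP sAE).
rewrite inE' => /andP[_ /hasP[w wC pw]]; exact: clC wC vR (adj_dual pw pv).
Qed.

(** A cell of [A] on side [d] with another cell of [A] adjacent to it yields a reduct cell on that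
    side. Without one, connectedness makes [A] a single cell, which cannot touch three sides when
    the size is at least 2. *)
Lemma reduct_touches A a b k d : A `<=` ups ((a, b), k.+2) -> connected A ->
  (forall c, touches ((a, b), k.+2) c A) ->
  touches ((a, b), k.+1) d (reduct A ((a, b), k.+2)).
Proof.
move=> sA cA tA; apply/negPn/negP => nt.
case/hasP: (tA d) => p pA tp.
have sAp : A `<=` [fset p].
  apply: cA; first by rewrite fsub1set.
    by apply/fset0Pn; exists p; rewrite inE.
  move=> q q'; rewrite !inE => /eqP-> qA /adjP[v pv qv].
  apply/negPn/negP; rewrite eq_sym => npq; case/negP: nt; apply/hasP; exists v.
    exact: reductI npq.
  have: v \in reduct A ((a, b), k.+2) by exact: reductI npq.
  rewrite in_reduct in_downs => /andP[h _].
  by move: h tp pv; rewrite in_nb; case: v p d {pA qv qA npq} => [x y] [i j] [] /=; lia.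
have tp' c : touch ((a, b), k.+2) c p.
  by case/hasP: (tA c) => q /(fsubsetP sAp); rewrite inE => /eqP ->.
by have := tp' dir1; have := tp' dir2; have := tp' dir3; case: p {tp tp' pA sAp} => [x y] /=; lia.
Qed.

(* At most one player wins the game of Y.  Replacing every downward cell by the
   majority colour of its three neighbours turns a board of size [k + 1] into one
   of size [k] and preserves the winning chains. *)
Lemma game_of_Y T A B : A `<=` ups T -> B `<=` ups T -> connected A -> connected B ->
  (forall d, touches T d A) -> (forall d, touches T d B) ->
  (forall x, x \in A -> x \in B -> False) -> False.
Proof.
case: T => [[a b] k]; elim: k A B => [|[|k] IH] A B sA sB cA cB tA tB dAB.
- by case/hasP: (tA dir1) => -[x y] /(fsubsetP sA); rewrite in_ups /=; lia.
- case/hasP: (tA dir1) => p pA _; case/hasP: (tB dir1) => q qB _.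
  move/(fsubsetP sA): (pA); move/(fsubsetP sB): (qB).
  case: p q pA qB => [x y] [x' y'] pA qB; rewrite !in_ups /= => h1 h2.
  have e : (x, y) = (x', y') by congr pair; lia.
  by apply: dAB pA _; rewrite e.
have sR X : reduct X ((a, b), k.+2) `<=` ups ((a, b), k.+1).
  by apply/fsubsetP => -[x y]; rewrite in_reduct in_downs in_ups /=; lia.
apply: (IH (reduct A ((a, b), k.+2)) (reduct B ((a, b), k.+2))) => //.
- exact: reduct_connected.
- exact: reduct_connected.
- by move=> d; apply: reduct_touches.
- by move=> d; apply: reduct_touches.
move=> v; rewrite !in_reduct => /andP[_ mA] /andP[_]; exact: majority_disjoint mA.
Qed.

(** * The excess inequality *)

(** The intersection of the closed parts of [W] containing [w]; quantifying over the powerset keeps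
    membership boolean. *)
Definition component (W : {fset point}) (w : point) : {fset point} :=
  [fset x in W | all (fun C : {fset point} =>
     (w \in C) && all (fun p => all (fun q => adj p q ==> (q \in C)) W) C ==> (x \in C))
     (fpowerset W)].

Lemma componentP (W : {fset point}) w x :
  reflect (x \in W /\ forall C, C `<=` W -> w \in C -> closed_in W C -> x \in C)
          (x \in component W w).
Proof.
rewrite mem_imfset //=; apply: (iffP andP) => -[xW h]; split=> //.
  move=> C sC wC clC; move/allP/(_ C): h; rewrite fpowersetE => /(_ sC)/implyP.
  apply; rewrite wC; apply/allP => p pC; apply/allP => q qW; apply/implyP.
  exact: clC.
apply/allP => C; rewrite fpowersetE => sC; apply/implyP => /andP[wC /allP clC].
by apply: h => // p q pC qW; move: (clC p pC) => /allP/(_ q qW)/implyP.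
Qed.

Lemma component_sub W w : component W w `<=` W.
Proof. by apply/fsubsetP => x /componentP[]. Qed.

Lemma component_refl (W : {fset point}) w : w \in W -> w \in component W w.
Proof. by move=> wW; apply/componentP. Qed.

Lemma component_closed W w : closed_in W (component W w).
Proof.
move=> p q /componentP[pW hp] qW pq; apply/componentP; split=> // C sC wC clC.
by apply: (clC p) => //; apply: hp.
Qed.

Lemma component_min (W : {fset point}) w C :
  C `<=` W -> w \in C -> closed_in W C -> component W w `<=` C.
Proof. by move=> sC wC clC; apply/fsubsetP => x /componentP[_]; apply. Qed.

Lemma component_connected (W : {fset point}) w : w \in W -> connected (component W w).
Proof.
move=> wW C sC /fset0Pn[z zC] clC; have sCW := fsubset_trans sC (component_sub W w).
have clCW : closed_in W C.
  move=> p q pC qW pq; apply: (clC p) => //.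
  exact: component_closed (fsubsetP sC p pC) qW pq.
case: (boolP (w \in C)) => wC; first exact: component_min.
(* If [C] misses [w], its complement in the component is closed, by symmetry of [adj], and contains
   [w]; by minimality it contains [z]. *)
have /componentP[_ /(_ (component W w `\` C))] := fsubsetP sC z zC.
move=> h; suff: z \in component W w `\` C by rewrite in_fsetD zC.
apply: h.
- by apply: fsubset_trans (component_sub W w); apply: fsubsetDl.
- by rewrite in_fsetD wC component_refl.
move=> p q; rewrite !in_fsetD => /andP[pC pK] qW pq.
rewrite (component_closed pK qW pq) andbT; apply: contra pC => qC.
by apply: (clC q) => //; rewrite adj_sym.
Qed.

Lemma component_adj (W : {fset point}) x y :
  x \in W -> y \in W -> adj x y -> component W x = component W y.
Proof.
move=> xW yW xy; apply/eqP; rewrite eqEfsubset.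
apply/andP; split; apply: component_min; try exact: component_sub;
  try exact: component_closed.
- by apply: (component_closed (component_refl yW)) => //; rewrite adj_sym.
- exact: (component_closed (component_refl xW)).
Qed.

(** [dir3] is a default; [game_of_Y] shows in [excess] that it is missed when the other two sides
    are touched. *)
Definition avoided (T : triangle) (K : {fset point}) : direction :=
  if ~~ touches T dir1 K then dir1 else if ~~ touches T dir2 K then dir2 else dir3.

(** The inverse of [nbr] in direction [d]; the truncated predecessor is harmless for cells of [T]
    not touching side [d]. *)
Definition far (d : direction) (w : point) : point :=
  match d with
  | dir1 => (w.1, w.2.-1)
  | dir2 => (w.1.-1, w.2)
  | dir3 => w
  end.

Lemma far_nbr v d : far d (nbr v d) = v.
Proof. by case: v d => [a b] []. Qed.

Lemma far_downs T d w : w \in ups T -> ~~ touch T d w ->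
  far d w \in downs T /\ nbr (far d w) d = w.
Proof.
case: T w => [[a b] k] [x y]; rewrite in_ups in_downs /nbr.
by case: d => /= h1 h2; split; try (congr pair); lia.
Qed.

(* Each component of [W] misses a side [d] of [T]; matching its upward cells across
   their sides parallel to [d] embeds [W] into the downward cells outside [X]. *)
Lemma excess (T : triangle) (A X : {fset point}) (W := ups T `\` A) :
  A `<=` ups T -> connected A -> (forall d, touches T d A) -> X `<=` downs T ->
  (forall v p, v \in X -> p \in nb v -> p \in A) ->
  #|` X| + T.2 <= #|` A| /\
  (#|` A| <= #|` X| + T.2 -> exists dir : point -> direction,
    [/\ forall w w', w \in W -> w' \in W -> adj w w' -> dir w = dir w',
        forall w, w \in W -> exists2 v, v \in downs T `\` X & w = nbr v (dir w)
      & forall v, v \in downs T `\` X -> exists2 w, w \in W & w = nbr v (dir w)]).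
Proof.
move=> sA cA tA sX nX; pose dir w := avoided T (component W w).
have sW : W `<=` ups T by apply: fsubsetDl.
have dirW w : w \in W -> ~~ touch T (dir w) w.
  move=> wW; suff: ~~ touches T (dir w) (component W w).
    by apply: contra => h; apply/hasP; exists w => //; apply: component_refl.
  rewrite /dir /avoided; case: ifP => // /negbFE t1; case: ifP => // /negbFE t2.
  apply/negP => t3; apply: (@game_of_Y T A (component W w)) => //.
  - by apply: fsubset_trans sW; apply: component_sub.
  - exact: component_connected.
  - by case.
  - by move=> x xA /(fsubsetP (component_sub W w)); rewrite inE xA.
have dir_adj w w' : w \in W -> w' \in W -> adj w w' -> dir w = dir w'.
  by move=> wW w'W ww'; rewrite /dir (component_adj wW w'W ww').
pose f w := far (dir w) w.
have fW w : w \in W -> f w \in downs T `\` X /\ nbr (f w) (dir w) = w.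
  move=> wW; have [fd fn] := far_downs (fsubsetP sW w wW) (dirW w wW).
  split=> //; rewrite inE fd andbT; apply/negP => /nX /(_ (nbr_nb (f w) (dir w))).
  by rewrite fn => wA; move: wW; rewrite inE wA.
(* Two cells with the same image surround it, so they are adjacent and move in the same
   direction. *)
have injf : {in W &, injective f}.
  move=> w w' wW w'W e; have [_ fw] := fW w wW; have [_ fw'] := fW w' w'W.
  have ww' : adj w w'.
    by apply: (@adj_nb (f w)); [rewrite -{1}fw|rewrite -{1}fw' -e]; apply: nbr_nb.
  by rewrite -fw -fw' e (dir_adj w w').
have sub : f @` W `<=` downs T `\` X.
  by apply/fsubsetP => _ /imfsetP[w /= wW ->]; case: (fW w wW).
have cW : #|` f @` W| = #|` W| by rewrite card_in_imfset.
have := fsubset_leq_card sub; rewrite cW !cardfsDS // => le.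
have := card_ups T; have := fsubset_leq_card sA; have := fsubset_leq_card sX.
move=> leX leA cT; split=> [|leAX]; first lia.
exists dir; split=> // [w wW|v vD].
  by case: (fW w wW) => h1 h2; exists (f w).
have /eqP e : f @` W == downs T `\` X.
  by rewrite eqEfcard sub cW !cardfsDS //; lia.
move: vD; rewrite -e => /imfsetP[w /= wW ->]; exists w => //.
by case: (fW w wW).
Qed.

(** * Counting in saturated triangles *)

Definition hole_ups (S : {fset triangle}) : {fset point} := \bigcup_(s <- S) ups s.
Definition hole_downs (S : {fset triangle}) : {fset point} := \bigcup_(s <- S) downs s.

Lemma hole_upsP (S : {fset triangle}) p :
  reflect (exists2 s, s \in S & p \in ups s) (p \in hole_ups S).
Proof.
apply: (iffP (bigfcupP _ _ _ _)) => [[s /andP[sS _] ps]|[s sS ps]]; exists s => //.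
by rewrite sS.
Qed.

Lemma hole_downsP (S : {fset triangle}) p :
  reflect (exists2 s, s \in S & p \in downs s) (p \in hole_downs S).
Proof.
apply: (iffP (bigfcupP _ _ _ _)) => [[s /andP[sS _] ps]|[s sS ps]]; exists s => //.
by rewrite sS.
Qed.

Lemma in_hole_Up S p : in_hole S (Up p) <-> p \in hole_ups S.
Proof.
split=> [[s sS]|/hole_upsP[s sS ps]]; last by exists s; rewrite ?cell_in_Up.
by rewrite cell_in_Up => ps; apply/hole_upsP; exists s.
Qed.

Lemma in_hole_Down S p : in_hole S (Down p) <-> p \in hole_downs S.
Proof.
split=> [[s sS]|/hole_downsP[s sS ps]]; last by exists s; rewrite ?cell_in_Down.
by rewrite cell_in_Down => ps; apply/hole_downsP; exists s.
Qed.

Definition free_ups n S := ups (Delta n) `\` hole_ups S.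
Definition free_downs n S := downs (Delta n) `\` hole_downs S.

Lemma free_cell_Up n S p : free_cell n S (Up p) <-> p \in free_ups n S.
Proof.
rewrite /free_cell /free_ups in_fsetD cell_in_Up in_hole_Up.
by split=> [[-> /negP->]|/andP[/negP ? ->]].
Qed.

Lemma free_cell_Down n S p : free_cell n S (Down p) <-> p \in free_downs n S.
Proof.
rewrite /free_cell /free_downs in_fsetD cell_in_Down in_hole_Down.
by split=> [[-> /negP->]|/andP[/negP ? ->]].
Qed.

Lemma short_diagonalE r p d : short_diagonal r (p, d) <-> r.1 = p /\ nbr r.2 d = p.
Proof.
case: r => u v; rewrite /short_diagonal /is_side /nbr /=; split.
  by case=> -[d1 [-> ->]] [d2 e2]; split=> //; case: d2 e2 => -[-> ->].
by case=> -> e; split; exists d => //; case: d e => /= ->.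
Qed.

Lemma is_rhombusP r : is_rhombus r <-> r.1 \in nb r.2.
Proof.
split=> [[[p d] /short_diagonalE[-> <-]]|/nbP[d e]]; first exact: nbr_nb.
by exists (r.1, d); apply/short_diagonalE.
Qed.

Lemma ups_cap s T p : (p \in ups (cap s T)) = (p \in ups s) && (p \in ups T).
Proof. by case: s T p => [[a b] k] [[x y] m] [i j]; rewrite !in_ups /cap /=; lia. Qed.

Lemma downs_cap s T p : (p \in downs (cap s T)) = (p \in downs s) && (p \in downs T).
Proof. by case: s T p => [[a b] k] [[x y] m] [i j]; rewrite !in_downs /cap /=; lia. Qed.

Section Arrangement.

Variables (n : nat) (S : {fset triangle}).
Hypothesis hS : arrangement n S.

Lemma ups_disjoint s t p :
  s \in S -> t \in S -> p \in ups s -> p \in ups t -> s = t.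
Proof.
move=> sS tS ps pt; case: hS => _ dS _; apply/eqP/negPn/negP => st.
by apply: (dS s t sS tS st (Up p)); rewrite !cell_in_Up.
Qed.

Lemma downs_disjoint s t p :
  s \in S -> t \in S -> p \in downs s -> p \in downs t -> s = t.
Proof.
move=> sS tS /(fsubsetP (downs_ups s)) ps /(fsubsetP (downs_ups t)).
exact: ups_disjoint.
Qed.

(** The holes cut [T] in disjoint triangles [cap s T], each with as many more upward than downward
    cells as its size. *)
Lemma card_hole_cap T : #|` ups T `&` hole_ups S| =
  #|` downs T `&` hole_downs S| + \sum_(s <- S) size_tri (cap s T).
Proof.
have -> : ups T `&` hole_ups S = \bigcup_(s <- S) ups (cap s T).
  apply/fsetP => p; rewrite in_fsetI; apply/andP/bigfcupP.
    by case=> pT /hole_upsP[s sS ps]; exists s; rewrite ?sS // ups_cap ps.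
  case=> s /andP[sS _]; rewrite ups_cap => /andP[ps ->]; split=> //.
  by apply/hole_upsP; exists s.
have -> : downs T `&` hole_downs S = \bigcup_(s <- S) downs (cap s T).
  apply/fsetP => p; rewrite in_fsetI; apply/andP/bigfcupP.
    by case=> pT /hole_downsP[s sS ps]; exists s; rewrite ?sS // downs_cap ps.
  case=> s /andP[sS _]; rewrite downs_cap => /andP[ps ->]; split=> //.
  by apply/hole_downsP; exists s.
rewrite (@card_bigfcup _ _ _ _ (fun s => ups (cap s T))) ?fset_uniq //; last first.
  move=> s t p sS tS; rewrite !ups_cap => /andP[ps _] /andP[pt _].
  exact: ups_disjoint ps pt.
rewrite (@card_bigfcup _ _ _ _ (fun s => downs (cap s T))) ?fset_uniq //; last first.
  move=> s t p sS tS; rewrite !downs_cap => /andP[ps _] /andP[pt _].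
  exact: downs_disjoint ps pt.
by rewrite -big_split /=; apply: eq_bigr => s _; apply: card_ups.
Qed.

(** The excess of upward cells in [T] and that in the parts of holes inside [T] both equal the size
    of [T], and cancel. *)
Lemma saturated_card T : saturated n S T ->
  #|` ups T `\` hole_ups S| = #|` downs T `\` hole_downs S|.
Proof.
case=> _ satT; have := card_hole_cap T; rewrite satT /size_tri.
have := card_ups T; have := cardfsID (hole_ups S) (ups T).
by have := cardfsID (hole_downs S) (downs T); lia.
Qed.

Lemma saturated_Delta : 0 < n -> saturated n S (Delta n).
Proof.
move=> n0; split; first by rewrite /upward_in /= add0n n0 leqnn.
case: hS => up _ sumS; rewrite -[RHS]sumS big_seq [RHS]big_seq; apply: eq_bigr => s sS.
by move: (up s sS); case: s {sS} => [[a b] k]; rewrite /upward_in /size_tri /cap /=; lia.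
Qed.

Lemma card_free : #|` free_ups n S| = #|` free_downs n S|.
Proof.
case: (posnP n) => [n0|]; last by move/saturated_Delta/saturated_card.
have := card_ups (Delta n); have := fsubset_leq_card (downs_ups (Delta n)).
have : ups (Delta n) = fset0.
  by apply/fsetP => -[x y]; rewrite in_ups !inE /=; lia.
rewrite /free_ups /free_downs => ->; rewrite cardfs0 fset0D cardfs0.
by rewrite leqn0 cardfs_eq0 => /eqP ->; rewrite fset0D cardfs0.
Qed.

Lemma hole_saturated s : spread_out n S -> s \in S -> saturated n S s.
Proof.
move=> spr sS; case: (hS) => up _ _; split; first exact: up.
apply/eqP; rewrite eqn_leq spr ?up // (big_fsetD1 s) //=.
case: s {sS} => [[a b] k]; rewrite /size_tri /cap /=; lia.
Qed.

Lemma saturated_free T p : saturated n S T ->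
  (p \in ups T `\` hole_ups S -> p \in free_ups n S) /\
  (p \in downs T `\` hole_downs S -> p \in free_downs n S).
Proof.
case: T p => [[a b] k] [x y] [up _].
rewrite /free_ups /free_downs !in_fsetD !in_ups !in_downs.
move: up; rewrite /upward_in /=; split=> /andP[-> /=]; lia.
Qed.

Section Tiling.

Variable R : {fset rhombus}.
Hypothesis hR : rhombus_tiling n S R.

Lemma tiling_uniq r r' c :
  r \in R -> r' \in R -> covers r c -> covers r' c -> r = r'.
Proof.
move=> rR r'R rc r'c; case: hR => free /(_ c) [|q [_ uq]].
  by apply: (free r rR).2.
by rewrite -(uq r) // -(uq r').
Qed.

(** The rhombi on the free downward cells of [T] have their upward cells in [T]. By [saturated_card]
    they use up all free upward cells of [T], so [r] is one of them. *)
Lemma tiling_saturated T r :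
  saturated n S T -> r \in R -> r.1 \in ups T -> r.2 \in downs T.
Proof.
move=> satT rR rT; case: (hR) => free cov.
pose UF := ups T `\` hole_ups S; pose DF := downs T `\` hole_downs S.
pose RT := [fset q in R | q.2 \in DF].
have inRT q : (q \in RT) = (q \in R) && (q.2 \in DF) by rewrite mem_imfset.
have freeU q : q \in R -> q.1 \notin hole_ups S.
  move=> qR; have /free_cell_Up : free_cell n S (Up q.1).
    by apply: (free q qR).2; left.
  by rewrite in_fsetD => /andP[].
have D2 : [fset q.2 | q in RT] = DF.
  apply/fsetP => v; apply/imfsetP/idP => [[q /=]|vD].
    by rewrite inRT => /andP[_ qD] ->.
  have /free_cell_Down/cov [q [[qR]]] := (saturated_free v satT).2 vD.
  by case=> // -[e] _; exists q; rewrite //= inRT qR -e.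
have sU : [fset q.1 | q in RT] `<=` UF.
  apply/fsubsetP => _ /imfsetP[q /= + ->]; rewrite inRT => /andP[qR qD].
  rewrite in_fsetD freeU //=; have /is_rhombusP := (free q qR).1.
  by apply: nb_downs; move: qD; rewrite in_fsetD => /andP[].
have c2 : #|` DF| = #|` RT|.
  rewrite -D2 card_in_imfset //= => q q'; rewrite !inRT.
  move=> /andP[qR _] /andP[q'R _] e.
  by apply: (tiling_uniq (c := Down q.2) qR q'R); right; rewrite // e.
have c1 : #|` [fset q.1 | q in RT]| = #|` RT|.
  rewrite card_in_imfset //= => q q'; rewrite !inRT.
  move=> /andP[qR _] /andP[q'R _] e.
  by apply: (tiling_uniq (c := Up q.1) qR q'R); left; rewrite // e.
have /eqP eU : [fset q.1 | q in RT] == UF.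
  by rewrite eqEfcard sU c1 -c2 (saturated_card satT) leqnn.
have : r.1 \in UF by rewrite in_fsetD freeU.
rewrite -eU => /imfsetP[q /=]; rewrite inRT => /andP[qR qD] e.
have -> : r = q by apply: (tiling_uniq (c := Up r.1) rR qR); left; rewrite // e.
by move: qD; rewrite in_fsetD => /andP[].
Qed.

End Tiling.

End Arrangement.

(** * Boundary segments and forcing *)

Lemma fset_argmin (A : {fset point}) (f : point -> nat) :
  A != fset0 -> exists2 p, p \in A & forall q, q \in A -> f p <= f q.
Proof.
case/fset0Pn => p; have [m] := ubnP (f p); elim: m p => // m IH p ltm pA.
case: (classic (exists2 q, q \in A & f q < f p)) => [[q qA ltq]|h].
  by apply: (IH q) => //; lia.
by exists p => // q qA; rewrite leqNgt; apply/negP => ltq; apply: h; exists q.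
Qed.

(** Unit steps lower the coordinate sum down to the corner [(a, b)]: a cell of [C] with minimal sum
    is that corner, and the reversed steps reach every cell from it. *)
Lemma ups_connected T : connected (ups T).
Proof.
case: T => [[a b] k] C sC C0 clC.
case: (fset_argmin (fun p => p.1 + p.2) C0) => -[x y] xyC minC.
have := fsubsetP sC _ xyC; rewrite in_ups /= => /and3P[ax by_ xyk].
have abC : (a, b) \in C.
  case: (ltnP a x) => hx.
    have /minC /= : (x.-1, y) \in C; last by lia.
    by apply: (clC (x, y)); rewrite ?in_ups /adj //=; lia.
  case: (ltnP b y) => hy.
    have /minC /= : (x, y.-1) \in C; last by lia.
    by apply: (clC (x, y)); rewrite ?in_ups /adj //=; lia.
  by have <- : (x, y) = (a, b) by congr pair; lia.
apply/fsubsetP => -[i j]; have [m] := ubnP (i + j); elim: m i j => // m IH i j ltm.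
rewrite in_ups /= => h; case: (ltnP a i) => hi.
  have iC : (i.-1, j) \in C by apply: IH; rewrite ?in_ups /=; lia.
  by apply: clC iC _ _; rewrite ?in_ups /adj /=; lia.
case: (ltnP b j) => hj.
  have jC : (i, j.-1) \in C by apply: IH; rewrite ?in_ups /=; lia.
  by apply: clC jC _ _; rewrite ?in_ups /adj /=; lia.
by have -> : (i, j) = (a, b) by congr pair; lia.
Qed.

Lemma on_boundaryP T p d : on_boundary T (p, d) <-> p \in ups T /\ touch T d p.
Proof.
case: T p => [[a b] k] [x y]; rewrite in_ups; split=> [[d']|[h t]].
  by case: d d' => -[]; rewrite /endpoints /on_side /pt_in /=; split; lia.
by exists d; case: d h t; rewrite /endpoints /on_side /pt_in /=; lia.
Qed.

Lemma touch_nbr T d v : touch T d (nbr v d) -> v \notin downs T.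
Proof. by case: T v d => [[a b] k] [x y] []; rewrite in_downs /=; lia. Qed.

Lemma boundary_or_across T p d : p \in ups T ->
  on_boundary T (p, d) \/ exists2 v, v \in downs T & nbr v d = p.
Proof.
move=> pT; case: (boolP (touch T d p)) => t; first by left; apply/on_boundaryP.
by right; exists (far d p); case: (far_downs pT t).
Qed.

Lemma nb_sub_downs T v : (forall p, p \in nb v -> p \in ups T) -> v \in downs T.
Proof.
move=> h; have := h _ (nbr_nb v dir1); have := h _ (nbr_nb v dir2).
have := h _ (nbr_nb v dir3); case: T v {h} => [[a b] k] [x y].
rewrite !in_ups in_downs /=; lia.
Qed.

Lemma is_side_Up u p d : is_side (Up u) (p, d) <-> u = p.
Proof. by split=> [[d' [->]]|->]; last exists d. Qed.

Lemma is_side_Down v p d : is_side (Down v) (p, d) <-> nbr v d = p.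
Proof.
split=> [[d' e]|<-]; first by case: d' e => -[-> ->].
by exists d; case: d.
Qed.

Lemma side_farE u v c : side (Up u) c = side (Down v) c <-> nbr v c = u.
Proof. by rewrite /nbr; case: c; split=> [[]|/= ->]. Qed.

Lemma rhombus_sideE r p d :
  rhombus_side r (p, d) <-> (r.1 = p \/ nbr r.2 d = p) /\ ~ (r.1 = p /\ nbr r.2 d = p).
Proof. by rewrite /rhombus_side short_diagonalE is_side_Up is_side_Down. Qed.

Lemma nbr_inj d v v' : nbr v d = nbr v' d -> v = v'.
Proof. by move/(congr1 (far d)); rewrite !far_nbr. Qed.

Lemma nbr_dir_inj v d d' : nbr v d = nbr v d' -> d = d'.
Proof. by case: v d d' => [x y] [] [] //; rewrite /nbr /= => -[]; lia. Qed.

(** Such a segment would give [r] and [r'] a common cell, hence [r = r'], but a side of [r] is not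
    its short diagonal. *)
Lemma tiling_side_not_diagonal n S R r r' e : rhombus_tiling n S R ->
  r \in R -> r' \in R -> rhombus_side r e -> ~ short_diagonal r' e.
Proof.
move=> hR rR r'R; case: e => p d; rewrite rhombus_sideE short_diagonalE.
case=> side_r not_diag [e1 e2]; apply: not_diag; suff -> : r = r' by [].
case: side_r => e.
  by apply: (tiling_uniq hR (c := Up p) rR r'R); left; rewrite ?e ?e1.
apply: (tiling_uniq hR (c := Down r.2) rR r'R); right => //.
by congr Down; apply: (@nbr_inj d); rewrite e e2.
Qed.

Lemma saturated_boundary_forced n S T e : arrangement n S ->
  saturated n S T -> on_boundary T e -> forced n S e.
Proof.
case: e => p d hS satT /on_boundaryP[pT tp] R hR r rR /short_diagonalE[e1 e2].
have := tiling_saturated hS hR satT rR; rewrite e1 => /(_ pT).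
by rewrite -e2 in tp; rewrite (negbTE (touch_nbr tp)).
Qed.

(** * Corner-placing runs *)

(** The tiling covers [Up r.1] by some rhombus. Its short diagonal is not a near side, which lies on
    the forced boundary or is a side of a rhombus already known to be in [R]; so it is the far
    side. *)
Lemma corner_run_tiling n S T c P R : arrangement n S -> saturated n S T ->
  rhombus_tiling n S R -> corner_run S T c P -> {subset P <= R}.
Proof.
move=> hS satT hR; elim=> // {}P r _ sP [uT nhole _ near /side_farE farE] q.
rewrite inE => /predU1P[->|]; last exact: sP.
have /free_cell_Up ufree : r.1 \in free_ups n S.
  apply: (saturated_free r.1 satT).1; rewrite in_fsetD -cell_in_Up uT andbT.
  by apply/negP => h; apply: nhole; apply/in_hole_Up.
case: (hR) => tile /(_ _ ufree) [{}q [[qR]]]; case=> // -[e1] _.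
have /is_rhombusP/nbP[d ed] := (tile q qR).1.
have qd : short_diagonal q (r.1, d) by rewrite short_diagonalE -ed e1.
case: (classic (d = c)) => [dc|/near []].
- suff -> : r = q by [].
  rewrite [r]surjective_pairing [q]surjective_pairing e1; congr pair.
  by apply: (@nbr_inj c); rewrite farE -dc -ed.
- by move=> bd; case: (saturated_boundary_forced hS satT bd hR qR).
- case=> q' /sP q'R sq'; by case: (tiling_side_not_diagonal hR q'R qR sq').
Qed.

Lemma complete_run S T c : exists P, corner_run S T c P /\ forall q, ~ can_place S T c P q.
Proof.
suff: forall P, corner_run S T c P -> exists P', corner_run S T c P' /\
    forall q, ~ can_place S T c P' q by apply; constructor.
move=> P; pose left (P : seq rhombus) := ups T `\` [fset r.1 | r in P].
have [m] := ubnP #|` left P|; elim: m P => // m IH P ltm runP.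
case: (classic (exists q, can_place S T c P q)) => [[q place]|done]; last first.
  by exists P; split=> // q h; apply: done; exists q.
apply: (IH (q :: P)); last by constructor.
suff: left (q :: P) `<` left P by move/fproper_ltn_card; lia.
have sub : left (q :: P) `<=` left P.
  apply: fsetDS; apply/fsubsetP => _ /imfsetP[r /= rP ->]; apply/imfsetP.
  by exists r; rewrite //= inE rP orbT.
case: place => qT _ ncov _ _; rewrite fproperE sub; apply/negP.
move/fsubsetP/(_ q.1); rewrite !in_fsetD -cell_in_Up qT !andbT => h.
have: q.1 \in [fset r.1 | r in q :: P].
  by apply/imfsetP; exists q; rewrite //= inE eqxx.
apply/negP; apply: h; apply/imfsetP => -[r /= rP e].
by apply: ncov; exists r => //; left; rewrite e.
Qed.

Lemma corner_run_far S T c P r : corner_run S T c P -> r \in P -> nbr r.2 c = r.1.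
Proof.
elim=> // {}P q _ IH [_ _ _ _ /side_farE e]; rewrite inE => /predU1P[->//|].
exact: IH.
Qed.

(** Up to an additive constant, the number of rows between [Up p], in [T], and the corner opposite
    to side [c]. *)
Definition corner_distance (T : triangle) (c : direction) (p : point) : nat :=
  match c with
  | dir1 => T.1.1 + T.1.2 + T.2 - p.2
  | dir2 => T.1.1 + T.1.2 + T.2 - p.1
  | dir3 => p.1 + p.2
  end.

Lemma corner_distance_lt T c d v : d <> c -> nbr v d \in ups T ->
  corner_distance T c (nbr v c) < corner_distance T c (nbr v d).
Proof.
case: T v => [[a b] k] [x y]; rewrite in_ups /nbr.
by case: c; case: d => //= _; lia.
Qed.

(** A criterion that constructs no particular run: if the cells of [W] avoid holes and [W] is closed
    under going towards the corner, a complete run covers it, by induction on [corner_distance]. *)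
Lemma corner_rhombusI S T c (W : point -> Prop) :
  (forall w, W w -> [/\ w \in ups T, w \notin hole_ups S & exists v, nbr v c = w]) ->
  (forall w d, W w -> d <> c ->
     on_boundary T (w, d) \/ exists2 v, nbr v d = w & W (nbr v c)) ->
  forall v, W (nbr v c) -> corner_rhombus S T c (nbr v c, v).
Proof.
move=> WT Wnear v0 Wv0; have [P [runP doneP]] := complete_run S T c.
exists P; split=> //; move: v0 Wv0.
suff H v : W (nbr v c) -> (nbr v c, v) \in P by [].
have [m] := ubnP (corner_distance T c (nbr v c)); elim: m v => // m IH v ltm Wv.
have [vT vS _] := WT _ Wv.
case: (classic (exists2 q, q \in P & covers q (Up (nbr v c)))) => [[q qP]|ncov].
  case=> // -[e]; suff -> : (nbr v c, v) = q by [].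
  rewrite e [q in RHS]surjective_pairing; congr pair.
  by apply: (@nbr_inj c); rewrite e (corner_run_far runP qP).
case: (doneP (nbr v c, v)); split=> //=.
- by rewrite cell_in_Up.
- by move/in_hole_Up; rewrite (negbTE vS).
- move=> d dc; case: (Wnear _ d Wv dc) => [|[w ew Ww]]; [by left|right].
  exists (nbr w c, w).
    apply: IH => //; have := corner_distance_lt dc (v := w) (T := T).
    by rewrite ew => /(_ vT); lia.
  apply/rhombus_sideE; split; [by right|case=> /= e _].
  by apply: dc; apply: (@nbr_dir_inj w); rewrite ew.
- by rewrite -[LHS]/(side (Up (nbr v c)) c); apply/side_farE.
Qed.

(** * Enclosing triangles, and tilings from matchings *)

Lemma hull_exists (n : nat) (A : {fset point}) : A != fset0 -> A `<=` ups (Delta n) ->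
  exists T, [/\ upward_in n T, A `<=` ups T & forall d, touches T d A].
Proof.
move=> A0 sA; have [p pA minp] := fset_argmin (fun p => p.1) A0.
have [q qA minq] := fset_argmin (fun p => p.2) A0.
(* This minimum is a maximum of the coordinate sum, as all sums are below [n]. *)
have [r rA minr] := fset_argmin (fun p => n - (p.1 + p.2)) A0.
have bd z : z \in A -> z.1 + z.2 < n.
  by move/(fsubsetP sA); case: z => x y; rewrite in_ups /=; lia.
exists ((p.1, q.2), (r.1 + r.2).+1 - (p.1 + q.2)).
have hr z : z \in A -> [/\ p.1 <= z.1, q.2 <= z.2 & z.1 + z.2 <= r.1 + r.2].
  move=> zA; split; [exact: minp|exact: minq|].
  have := minr z zA; have := bd z zA; have := bd r rA.
  by case: r z {zA minr rA} => [x y] [i j] /=; lia.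
have [h1 h2 _] := hr r rA; have h3 := bd r rA; split.
- by move: h1 h2 h3; rewrite /upward_in /=; case: p q r {pA minp qA minq rA minr hr}
    => [x y] [x' y'] [i j] /=; lia.
- apply/fsubsetP => z zA; have := hr z zA; rewrite in_ups /=.
  by move: h1 h2 h3; case: p q r z {pA minp qA minq rA minr hr zA}
    => [x y] [x' y'] [i j] [i' j'] /= h1 h2 h3 [h4 h5 h6]; lia.
- case; apply/hasP; [exists q|exists p|exists r] => //=.
  by move: h1 h2 h3; case: p q r {pA minp qA minq rA minr hr}
    => [x y] [x' y'] [i j] /=; lia.
Qed.

(** By [card_free] the injection is onto the free upward cells, so these are covered exactly once
    too. *)
Lemma tiling_of_matching n S (g : point -> point) : arrangement n S ->
  {in free_downs n S &, injective g} ->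
  (forall b, b \in free_downs n S -> g b \in free_ups n S /\ g b \in nb b) ->
  rhombus_tiling n S [fset (g b, b) | b in free_downs n S].
Proof.
move=> hS injg gP; pose D := free_downs n S.
have cardg : #|` g @` D| = #|` D| by rewrite card_in_imfset.
have /eqP img : g @` D == free_ups n S.
  rewrite eqEfcard cardg (card_free hS) leqnn andbT.
  by apply/fsubsetP => _ /imfsetP[b /= /gP[h _] ->].
split=> [_ /imfsetP[b /= bD ->]|c freec].
  have [gU gb] := gP b bD; split; first exact/is_rhombusP.
  by move=> c [->|->]; [apply/free_cell_Up|apply/free_cell_Down].
case: c freec => p.
  move/free_cell_Up; rewrite -img => /imfsetP[b /= bD ->]; exists (g b, b); split.
    by split; [apply/imfsetP; exists b|left].
  move=> _ [/imfsetP[b' /= b'D ->]]; case=> // -[e].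
  by rewrite (injg _ _ bD b'D e).
move/free_cell_Down => pD; exists (g p, p); split.
  by split; [apply/imfsetP; exists p|right].
by move=> _ [/imfsetP[b' /= b'D ->]]; case=> // -[->].
Qed.

(** Size is the number of upward minus downward cells, and [cap s T] has the same cells as [s]. *)
Lemma size_cap_sub s T : ups s `<=` ups T -> size_tri s <= size_tri (cap s T).
Proof.
move=> sub; have e : ups (cap s T) = ups s.
  by apply/fsetP => p; rewrite ups_cap; apply: andb_idr => /(fsubsetP sub).
have eD : downs (cap s T) = downs s.
  apply/fsetP => p; rewrite downs_cap; apply: andb_idr => ps.
  by apply: nb_sub_downs => q /(nb_downs ps) /(fsubsetP sub).
have := card_ups s; have := card_ups (cap s T).
by rewrite e eD /size_tri => ->; lia.
Qed.

Lemma ups_size0 p T : size_tri T = 0 -> (p \in ups T) = false.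
Proof. by case: T p => [[a b] k] [x y]; rewrite in_ups /size_tri /=; lia. Qed.

(** The closed chain [b + D + k <= a = f + D + k0 <= b + D + c <= b + D + k] forces equality
    throughout. Here [a] and [x] stand for the cardinals of [A] and [X], [k] for the size of [T],
    [c] and [c'] for the shares of touched and untouched holes. *)
Lemma squeeze_eq a x f b U D k0 c c' k : x + k <= a -> a = f + U -> x = b + D ->
  U = D + k0 -> k0 <= c -> c + c' <= k -> f <= b ->
  [/\ c + c' = k, c' = 0, b <= f & a <= x + k].
Proof. by move=> *; split; lia. Qed.

(** * From a minimal violator to a saturated triangle *)

Definition partners n S u (b : point) : {fset point} :=
  (nb b `&` free_ups n S) `\ u.

Section Violator.

Variables (n : nat) (S : {fset triangle}) (u : point) (B : {fset point}).
Hypothesis hS : arrangement n S.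
Hypothesis hspread : spread_out n S.

Let r := partners n S u.
Hypothesis sB : B `<=` free_downs n S.
Hypothesis violB : #|` neighbours r B| < #|` B|.
Hypothesis minB : forall B', B' `<` B -> #|` B'| <= #|` neighbours r B'|.

Let N := neighbours nb B.
Let touched s := has (fun p => p \in N) (ups s).
(** Touched holes enter [X] and [A] whole, so each adds exactly its size to the difference of the
    cardinals. *)
Let X := B `|` \bigcup_(s <- S | touched s) downs s.
Let A := N `|` \bigcup_(s <- S | touched s) ups s.

Let inA p : reflect (p \in N \/ exists s, [/\ s \in S, touched s & p \in ups s]) (p \in A).
Proof.
apply: (iffP (fsetUP _ _ _)) => -[h|h]; try by left.
  by right; case/bigfcupP: h => s /andP[sS ts] ps; exists s.
by right; case: h => s [sS ts ps]; apply/bigfcupP; exists s; rewrite ?sS.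
Qed.

Let sBD b : b \in B -> b \in downs (Delta n) /\ b \notin hole_downs S.
Proof. by move/(fsubsetP sB); rewrite in_fsetD => /andP[]. Qed.

(** The neighbours of each [b] are all in [C] or all outside. If both kinds occur, they split [B]
    into proper parts with disjoint neighbourhoods; minimality gives the marriage inequality for
    each and, by addition, for [B], against [violB]. *)
Let violator_connected : connected A.
Proof.
move=> C sC /fset0Pn[z zC] clC.
have nbA b p : b \in B -> p \in nb b -> p \in A.
  by move=> bB pb; apply/inA; left; apply/neighboursP; exists b.
have nbC b p q : b \in B -> p \in nb b -> p \in C -> q \in nb b -> q \in C.
  by move=> bB pb pC qb; apply: (clC p) => //; [exact: nbA qb|exact: adj_nb pb qb].
have holeC s p : s \in S -> touched s -> p \in ups s -> p \in C -> ups s `<=` C.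
  move=> sS ts ps pC; suff : ups s `<=` ups s `&` C.
    by move/fsubset_trans; apply; apply: fsubsetIr.
  apply: ups_connected; first exact: fsubsetIl.
    by apply/fset0Pn; exists p; rewrite in_fsetI ps.
  move=> x y /fsetIP[xs xC] ys xy; rewrite in_fsetI ys; apply: (clC x) => //.
  by apply/inA; right; exists s.
have NC_AC : (forall p, p \in N -> p \in C) -> A `<=` C.
  move=> NC; apply/fsubsetP => p /inA[/NC//|[s [sS ts ps]]].
  case/hasP: (ts) => q qs qN; exact: (fsubsetP (holeC s q sS ts qs (NC q qN))).
(* Each touched hole is connected and meets [N], so [C] reaches [N] even from inside a hole. *)
have [p0 p0N p0C] : exists2 p, p \in N & p \in C.
  case/inA: (fsubsetP sC z zC) => [zN|[s [sS ts zs]]]; first by exists z.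
  case/hasP: (ts) => q qs qN; exists q => //.
  exact: (fsubsetP (holeC s z sS ts zs zC)).
pose B1 := [fset b in B | nbr b dir3 \in C].
have inB1 b : (b \in B1) = (b \in B) && (nbr b dir3 \in C) by rewrite mem_imfset.
have sB1 : B1 `<=` B by apply/fsubsetP => b; rewrite inB1 => /andP[].
have B1P b p : b \in B -> p \in nb b -> (p \in C) = (b \in B1).
  move=> bB pb; rewrite inB1 bB /=; apply/idP/idP => h.
    exact: (nbC b p _ bB pb h (nbr_nb _ _)).
  exact: (nbC b _ _ bB (nbr_nb _ _) h pb).
have [B1B|B1B] := eqVneq B1 B.
  by apply: NC_AC => p /neighboursP[b bB pb]; rewrite (B1P b) ?B1B.
have lt1 : B1 `<` B by rewrite fproperEneq B1B.
have lt2 : B `\` B1 `<` B.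
  rewrite fproperEcard fsubsetDl cardfsDS //= ltn_subrL.
  have B1_gt0 : 0 < #|` B1|.
    case/neighboursP: p0N => b bB pb; rewrite cardfs_gt0; apply/fset0Pn.
    by exists b; rewrite -(B1P b p0).
  by rewrite B1_gt0 (leq_trans B1_gt0) ?fsubset_leq_card.
have sum : #|` neighbours r B1 `|` neighbours r (B `\` B1)| =
    #|` neighbours r B1| + #|` neighbours r (B `\` B1)|.
  apply: card_disjointU => x /neighboursP[b bB1 xb] /neighboursP[b' b'B2 xb'].
  move: xb xb'; rewrite /r /partners !in_fsetD1 !in_fsetI => /andP[_ /andP[xb _]].
  case/andP=> _ /andP[xb' _]; move: b'B2; rewrite in_fsetD => /andP[nb' b'B].
  by move/negP: nb'; apply; rewrite -(B1P b' x) // (B1P b x) // (fsubsetP sB1).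
have : neighbours r B1 `|` neighbours r (B `\` B1) `<=` neighbours r B.
  apply/fsubsetP => x /fsetUP[]/neighboursP[b bB xb]; apply/neighboursP; exists b => //.
    exact: (fsubsetP sB1).
  exact: (fsubsetP (fproper_sub lt2)).
move/fsubset_leq_card; rewrite sum => le_r.
have := minB lt2; rewrite cardfsDS // leq_subLR => /leq_trans.
move/(_ _ (leq_add (minB lt1) (leqnn _)))/leq_trans/(_ le_r).
by rewrite leqNgt violB.
Qed.

Let sNU : N `<=` ups (Delta n).
Proof.
by apply/fsubsetP => p /neighboursP[b /sBD[bD _] pb]; apply: nb_downs pb.
Qed.

Let sAU : A `<=` ups (Delta n).
Proof.
apply/fsubsetP => p /inA[|[s [sS _ ps]]]; first exact: (fsubsetP sNU).
case: hS => up _ _; move: (up s sS) ps; case: s {sS} => [[a b] k].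
by case: p => x y; rewrite /upward_in !in_ups /=; lia.
Qed.

Let F := N `\` hole_ups S.

Let cardA : #|` A| = #|` F| + \sum_(s <- S | touched s) #|` ups s|.
Proof.
rewrite -(@card_bigfcup _ _ _ _ (fun s => ups s)) ?fset_uniq //; last first.
  by move=> s t p sS tS; apply: (ups_disjoint hS).
rewrite -card_disjointU; last first.
  move=> p; rewrite in_fsetD => /andP[/negP nh _] /bigfcupP[s /andP[sS _] ps].
  by apply: nh; apply/hole_upsP; exists s.
congr (#|` _|); apply/fsetP => p; apply/inA/fsetUP => -[].
- move=> pN; case: (boolP (p \in hole_ups S)) => [/hole_upsP[s sS ps]|ph].
    right; apply/bigfcupP; exists s; rewrite // sS /=.
    by apply/hasP; exists p.
  by left; rewrite in_fsetD ph.
- by case=> s [sS ts ps]; right; apply/bigfcupP; exists s; rewrite ?sS.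
- by rewrite in_fsetD => /andP[_ pN]; left.
- by case/bigfcupP => s /andP[sS ts] ps; right; exists s.
Qed.

Let cardX : #|` X| = #|` B| + \sum_(s <- S | touched s) #|` downs s|.
Proof.
rewrite -(@card_bigfcup _ _ _ _ (fun s => downs s)) ?fset_uniq //; last first.
  by move=> s t p sS tS; apply: (downs_disjoint hS).
apply: card_disjointU => p /sBD[_ /negP nh] /bigfcupP[s /andP[sS _] ps].
by apply: nh; apply/hole_downsP; exists s.
Qed.

Let sFr : F `<=` u |` neighbours r B.
Proof.
apply/fsubsetP => p; rewrite in_fsetD => /andP[ph pN]; rewrite in_fset1U.
have [//|pu] /= := eqVneq p u; case/neighboursP: (pN) => b bB pb.
apply/neighboursP; exists b => //; rewrite /r /partners in_fsetD1 pu in_fsetI pb /=.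
by rewrite in_fsetD ph (fsubsetP sNU).
Qed.

(** Removing [u] loses at most one neighbour, and [violB] is strict. *)
Let leFB : #|` F| <= #|` B|.
Proof.
have := fsubset_leq_card sFr; rewrite cardfsU1.
by move: violB; case: (_ \notin _) => /=; lia.
Qed.

Let uF : #|` B| <= #|` F| -> u \in F.
Proof.
move=> le; apply/negPn/negP => nuF; have : F `<=` neighbours r B.
  apply/fsubsetP => p pF; have := fsubsetP sFr p pF; rewrite in_fset1U.
  by case/orP=> // /eqP e; rewrite -e pF in nuF.
by move/fsubset_leq_card; move: violB; lia.
Qed.

Let nbX v p : v \in X -> p \in nb v -> p \in A.
Proof.
case/fsetUP => [vB|/bigfcupP[s /andP[sS ts] vs]] pv; apply/inA.
  by left; apply/neighboursP; exists v.
by right; exists s; split=> //; apply: nb_downs pv.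
Qed.

Lemma violator_segment v d : v \in free_downs n S -> v \notin B -> nbr v d = u ->
  exists T, saturated n S T /\ (on_boundary T (u, d) \/
    exists c q, corner_rhombus S T c q /\ rhombus_side q (u, d)).
Proof.
move=> vfree vB vu.
have A0 : A != fset0.
  case: (fset_0Vmem B) => [B0|[b bB]]; first by move: violB; rewrite B0 cardfs0.
  by apply/fset0Pn; exists (nbr b dir3); apply: nbX (nbr_nb _ _); apply/fsetUP; left.
have [T [upT sAT tT]] := hull_exists A0 sAU.
have sXT : X `<=` downs T.
  by apply/fsubsetP => x xX; apply: nb_sub_downs => p /(nbX xX) /(fsubsetP sAT).
have [lowA eqA] := excess sAT violator_connected tT sXT nbX.
have sumU : \sum_(s <- S | touched s) #|` ups s| =
    \sum_(s <- S | touched s) #|` downs s| + \sum_(s <- S | touched s) size_tri s.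
  by rewrite -big_split /=; apply: eq_bigr => s _; apply: card_ups.
have sumC : \sum_(s <- S | touched s) size_tri s <=
    \sum_(s <- S | touched s) size_tri (cap s T).
  rewrite big_seq_cond [X in _ <= X]big_seq_cond; apply: leq_sum => s /andP[sS ts].
  apply: size_cap_sub; apply/fsubsetP => p ps; apply: (fsubsetP sAT).
  by apply/inA; right; exists s.
have sumT := hspread upT; rewrite (bigID touched) /= in sumT.
(* All bounds are tight: [T] is saturated, untouched holes share no cell with [T], and the equality
   case of [excess] applies. *)
have [sumS rest0 leBF leAX] := squeeze_eq lowA cardA cardX sumU sumC sumT leFB.
have u_in_F := uF leBF.
have uA : u \in A by apply/inA; left; move: u_in_F; rewrite in_fsetD => /andP[].
have [dir [dir_adj farW surjW]] := eqA leAX.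
exists T; split; first by split; rewrite // (bigID touched).
have vX : v \notin X.
  apply/negP => /fsetUP[|/bigfcupP[s /andP[sS _] vs]]; first exact/negP.
  move: vfree; rewrite in_fsetD => /andP[/negP nh _]; apply: nh.
  by apply/hole_downsP; exists s.
case: (boundary_or_across d (fsubsetP sAT u uA)) => [|[v' v'T]]; first by left.
rewrite -vu => /nbr_inj ev; rewrite {v'}ev in v'T; right.
(* The matching of [excess] is now onto and reaches [Down v]. As [u] is in [A] and [w] is not,
   [(u, d)] is a side of [(w, v)], not its diagonal. *)
have [|w wW ew] := surjW v; first by rewrite in_fsetD vX.
exists (dir w), (w, v); split; last first.
  apply/rhombus_sideE; split; first by right.
  by case=> /= wu _; move: wW; rewrite wu vu in_fsetD uA.
rewrite {2}ew.
(* The cells outside [A] with the direction of [w] avoid holes, since a hole sharing a cell with [T]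
   is touched and so lies in [A]. Across a near side off the boundary, the downward cell has an
   adjacent partner, hence of the same direction. *)
apply: (corner_rhombusI (W := fun x => x \in ups T `\` A /\ dir x = dir w)).
- move=> x [xW dx]; move: (xW); rewrite in_fsetD => /andP[xA xT]; split=> //.
    apply/negP => /hole_upsP[s sS xs].
    have nts : ~~ touched s.
      by apply: contra xA => ts; apply/inA; right; exists s.
    have : size_tri (cap s T) = 0.
      apply/eqP; move/eqP: rest0; rewrite sum_nat_seq_eq0 => /allP/(_ s sS).
      by rewrite nts.
    have : x \in ups (cap s T) by rewrite ups_cap xs.
    by move=> + /(ups_size0 x) => ->.
  by case: (farW x xW) => y _ ->; exists y; rewrite -?dx.
- move=> x d' [xW dx] d'w; move: (xW); rewrite in_fsetD => /andP[xA xT].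
  case: (boundary_or_across d' xT) => [|[y yT ey]]; [by left|right].
  exists y => //; have [|z zW ez] := surjW y.
    rewrite in_fsetD yT andbT; apply: contra xA => yX; apply: nbX yX _.
    by rewrite -ey nbr_nb.
  have dz : dir z = dir w.
    rewrite -dx; apply: dir_adj => //; apply: (@adj_nb y).
      by rewrite ez nbr_nb.
    by rewrite -ey nbr_nb.
  by rewrite -dz -ez.
by rewrite -ew.
Qed.

End Violator.

(** * The characterisation of forced segments *)

Theorem mainTheorem4 (n : nat) (S : {fset triangle})
    (hS : arrangement n S) (hspread : spread_out n S)
    (e : segment) (he : seg_in (Delta n) e) (hint : ~ in_hole_interior S e) :
  forced n S e <->
    (exists T, saturated n S T /\ on_boundary T e) \/
    (exists T c r, [/\ saturated n S T, corner_rhombus S T c r & rhombus_side r e]).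
Proof.
split; last first.
  case=> [[T [satT bT]]|[T [c [r [satT [P [runP _ rP]] side_r]]]]].
    exact: saturated_boundary_forced bT.
  move=> R hR r' r'R; have rR := corner_run_tiling hS satT hR runP rP.
  exact: tiling_side_not_diagonal hR rR r'R side_r.
case: e he hint => u d he hint force.
have segU T : seg_in T (u, d) = (u \in ups T).
  case: T u {he hint force} => [[a b] k] [x y].
  by rewrite in_ups; case: d; rewrite /seg_in /endpoints /pt_in /=; lia.
have uD : u \in ups (Delta n) by rewrite -segU.
have n0 : 0 < n by move: uD; rewrite in_ups /=; lia.
case: (boundary_or_across d uD) => [bD|[v vD vu]].
  by left; exists (Delta n); split=> //; apply: saturated_Delta.
(* A hole is itself saturated, and a segment of it not in its interior is on its boundary. *)
have hole s : s \in S -> u \in ups s -> exists T, saturated n S T /\ on_boundary T (u, d).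
  move=> sS us; exists s; split; first exact: hole_saturated.
  apply: NNPP => nb_s; apply: hint; exists s; split=> //.
  by rewrite segU.
case: (boolP (u \in hole_ups S)) => [/hole_upsP[s sS us]|uh].
  by left; apply: hole us.
case: (boolP (v \in hole_downs S)) => [/hole_downsP[s sS vs]|vh].
  by left; apply: (hole s) => //; apply: nb_downs vs _; rewrite -vu nbr_nb.
have ufree : u \in free_ups n S by rewrite in_fsetD uh.
have vfree : v \in free_downs n S by rewrite in_fsetD vh.
pose r := partners n S u; pose D := free_downs n S `\ v.
(* If Hall's condition held without [u] and [v], a matching completed by the pair [(u, v)] would be
   a tiling with the forced segment as a short diagonal. *)
have [B0 [sB0 viol0]] : exists B, B `<=` D /\ #|` neighbours r B| < #|` B|.
  apply: NNPP => nviol; have [|f [injf fr]] := @hall _ _ u D r.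
    move=> B sB; rewrite leqNgt; apply/negP => viol; apply: nviol; by exists B.
  have fP b : b \in free_downs n S -> b != v ->
      [/\ f b \in nb b, f b \in free_ups n S & f b != u].
    move=> bF bv; have := fr b; rewrite in_fsetD1 bv bF => /(_ isT).
    by rewrite /r /partners in_fsetD1 in_fsetI => /and3P[].
  pose g b := if b == v then u else f b.
  have gP b : b \in free_downs n S -> g b \in free_ups n S /\ g b \in nb b.
    rewrite /g; have [->|bv] := eqVneq b v; first by rewrite -{2}vu nbr_nb.
    by move=> bF; case: (fP b bF bv).
  have injg : {in free_downs n S &, injective g}.
    move=> b b' bF b'F; rewrite /g.
    have [->|bv] := eqVneq b v; have [->|b'v] := eqVneq b' v => // eq_g.
    - by case: (fP b' b'F b'v); rewrite -eq_g eqxx.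
    - by case: (fP b bF bv); rewrite eq_g eqxx.
    - by apply: injf; rewrite // in_fsetD1 ?bv ?b'v.
  apply: (force _ (tiling_of_matching hS injg gP) (g v, v)).
    by apply/imfsetP; exists v.
  by apply/short_diagonalE; rewrite /g eqxx.
have [B [sB viol minB]] := minimal_violator viol0.
have sBD : B `<=` D := fsubset_trans sB sB0.
have sBF : B `<=` free_downs n S by apply: fsubset_trans sBD _; apply: fsubD1set.
have vB : v \notin B by apply/negP => /(fsubsetP sBD); rewrite in_fsetD1 eqxx.
have [T [satT [bT|[c [q [cq sq]]]]]] :=
  violator_segment hS hspread sBF viol minB vfree vB vu.
  by left; exists T.
by right; exists T, c, q.
Qed.
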